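(* Let $A,B$ be real symmetric $n\times n$ matrices, $a,b\in\mathbb{R}^n$, $k_1,k_2\in\mathbb{R}$, and $$f(x)=\tfrac12\langle Ax,x\rangle+\langle a,x\rangle+k_1,\qquad g(x)=\tfrac12\langle Bx,x\rangle+\langle b,x\rangle+k_2,\qquad x\in\mathbb{R}^n.$$ Let $P$ be either $\mathbb{R}_+$ or $\{0\}$, suppose $0\in\operatorname{ri}(g(\mathbb{R}^n)+P)$ and $\mu:=\inf\{f(x): g(x)\in-P,\ x\in\mathbb{R}^n\}\in\mathbb{R}$. In case $P=\{0\}$, assume additionally that $g\not\equiv 0$ and that at least one of the following conditions holds: (C1) $B=0$ and there exists $u\in\ker A$ such that $(\langle a,u\rangle,\langle b,u\rangle)\neq(0,0)$; (C2) $B\neq 0$; (C3) $B=0$ and $A\succcurlyeq 0$. Then strong duality holds for the problem of minimizing $f$ subject to $g(x)\in-P$, that is, there exists $\lambda^*\in P^*$ such that $$\inf_{g(x)\in-P}f(x)=\inf_{x\in\mathbb{R}^n}[f(x)+\lambda^*g(x)].$$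
   Context: $\mathbb{R}_+=[0,+\infty[$. $\operatorname{ri}$ denotes the relative interior (interior relative to the affine hull). $P^*=\{\xi\in\mathbb{R}:\xi p\ge0\ \forall p\in P\}$, so $P^*=\mathbb{R}_+$ if $P=\mathbb{R}_+$ and $P^*=\mathbb{R}$ if $P=\{0\}$. $A\succcurlyeq0$ means $\langle Ax,x\rangle\ge0$ for all $x$. *)

(* Defs.v *)
From mathcomp Require Export all_boot all_order all_algebra.
From mathcomp Require Export boolp classical_sets reals ereal topology normedtype.

Set Implicit Arguments.
Unset Strict Implicit.
Unset Printing Implicit Defensive.

Import Order.TTheory GRing.Theory Num.Theory numFieldNormedType.Exports.

Local Open Scope classical_set_scope.
Local Open Scope ring_scope.

Definition dot (R : realType) (n : nat) (u v : 'cV[R]_n) : R :=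
  \sum_(i < n) u i 0 * v i 0.

Definition quadfun (R : realType) (n : nat) (A : 'M[R]_n) (a : 'cV[R]_n) (k : R)
    (x : 'cV[R]_n) : R :=
  2^-1 * dot (A *m x) x + dot a x + k.

Definition psd (R : realType) (n : nat) (A : 'M[R]_n) : Prop :=
  forall x : 'cV[R]_n, 0 <= dot (A *m x) x.

Definition set_add (V : zmodType) (S T : set V) : set V :=
  [set s + t | s in S & t in T].

Definition set_opp (V : zmodType) (S : set V) : set V := [set - s | s in S].

Definition affine_hull (R : realType) (V : lmodType R) (S : set V) : set V :=
  [set z | exists (m : nat) (c : 'I_m -> R) (v : 'I_m -> V),
     [/\ \sum_(i < m) c i = 1, forall i, S (v i) & z = \sum_(i < m) c i *: v i]].

(* Membership in [S] itself follows from the two conditions, since the second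
   one concerns every point of the hull near [x], including [x]. *)
Definition ri (R : realType) (V : normedModType R) (S : set V) : set V :=
  [set x | affine_hull S x /\ within (affine_hull S) (nbhs x) S].

Definition polar_cone (R : realType) (P : set R) : set R :=
  [set xi | forall p, P p -> 0 <= xi * p].

(* The infimum is taken in the extended reals ([+oo] on the empty set), so it
   is a real number exactly when the domain is nonempty and the function is
   bounded below on it. *)
Definition infimum (R : realType) (T : Type) (f : T -> R) (D : set T) : \bar R :=
  ereal_inf [set (f x)%:E | x in D].

(* Main.v *)
(* With [mu] the optimal value and [q = f - mu], a multiplier [lambda] with
   [q + lambda g >= 0] exists as soon as [g y * q x <= g x * q y] whenever
   [g y < 0 < g x]. On the line through [x] and [y], homogenized, [g] is a
   binary quadratic form with one root on each side of [x], and [q >= 0] at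
   both roots; a convex combination of these two inequalities is the desired
   one. The only obstruction is a root at infinity, i.e. [y - x] isotropic for
   [B]: it is removed by perturbing [y] if [B <> 0], while if [B = 0] it suffices
   that [A] is nonnegative at [y - x]. Under (C1) the multiplier is explicit:
   [f + lambda g] is made invariant along [u]. *)
Require Import Defs.
From mathcomp Require Import ring lra.
Import Order.TTheory GRing.Theory Num.Theory numFieldNormedType.Exports.

Local Open Scope classical_set_scope.
Local Open Scope ring_scope.

Set Implicit Arguments.
Unset Strict Implicit.

(** * Sign conditions on real quadratics in one variable *)

(** As [p * r < 0], the discriminant exceeds [m ^+ 2], so its square root dominates [|m|] and the
    roots straddle 0; the last identity is Vieta's formula. *)
Lemma opposite_sign_roots (R : rcfType) (p m r : R) : 0 < p -> r < 0 ->
  exists t1 t2 : R, [/\ t1 < 0, 0 < t2, p + t1 * m + t1 ^+ 2 * r = 0,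
    p + t2 * m + t2 ^+ 2 * r = 0 & t1 * t2 * r = p].
Proof.
move=> p0 r0; set D := m ^+ 2 - 4 * p * r.
have D0 : 0 <= D by rewrite /D; nra.
set w := Num.sqrt D; have wE : w ^+ 2 = D by rewrite sqr_sqrtr.
have w0 : 0 <= w by exact: sqrtr_ge0.
have mw : `|m| < w.
  by rewrite -(ger0_norm w0) -ltr_sqr ?nnegrE// -!normrX !ger0_norm ?sqr_ge0// wE /D; nra.
move: mw; rewrite ltr_norml => /andP[mw1 mw2].
have rn : r != 0 by lra.
exists ((- m + w) / (2 * r)), ((- m - w) / (2 * r)); split.
- by rewrite pmulr_rlt0 ?invr_lt0; lra.
- by rewrite nmulr_rgt0 ?invr_lt0; lra.
- have -> : p + (- m + w) / (2 * r) * m + ((- m + w) / (2 * r)) ^+ 2 * r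
    = (w ^+ 2 - D) / (4 * r) by rewrite /D; field.
  by rewrite wE subrr mul0r.
- have -> : p + (- m - w) / (2 * r) * m + ((- m - w) / (2 * r)) ^+ 2 * r
    = (w ^+ 2 - D) / (4 * r) by rewrite /D; field.
  by rewrite wE subrr mul0r.
- have -> : (- m + w) / (2 * r) * ((- m - w) / (2 * r)) * r
    = p + (D - w ^+ 2) / (4 * r) by rewrite /D; field.
  by rewrite wE subrr mul0r addr0.
Qed.

(* A weighted sum of the two inequalities at the roots kills the middle
   coefficient [l]. *)
Lemma binary_form_Slemma (R : rcfType) (p m r q l s : R) : 0 < p -> r < 0 ->
  (forall t, p + t * m + t ^+ 2 * r = 0 -> 0 <= q + t * l + t ^+ 2 * s) ->
  r * q <= p * s.
Proof.
move=> p0 r0 H.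
have [t1 [t2 [t10 t20 /H h1 /H h2 t12]]] := opposite_sign_roots m p0 r0.
have : 0 <= (t2 - t1) * (q - t1 * t2 * s).
  have -> : (t2 - t1) * (q - t1 * t2 * s) =
    t2 * (q + t1 * l + t1 ^+ 2 * s) + (- t1) * (q + t2 * l + t2 ^+ 2 * s) by ring.
  by rewrite addr_ge0// mulr_ge0//; lra.
rewrite pmulr_rge0; last lra.
move=> h; have : r * (q - t1 * t2 * s) <= 0 by rewrite nmulr_rle0.
have -> : r * (q - t1 * t2 * s) = r * q - t1 * t2 * r * s by ring.
by rewrite t12 subr_le0.
Qed.

(* In homogeneous coordinates on the line, [s = t / (1 + t)]; the hypothesis
   [be = 0 -> 0 <= al] covers the point at infinity [t = -1]. *)
Lemma segment_Slemma (R : rcfType) (gx gy be qx qy al : R) :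
  0 < gx -> gy < 0 ->
  (forall s, (1 - s) * gx + s * gy - s * (1 - s) * be = 0 ->
     0 <= (1 - s) * qx + s * qy - s * (1 - s) * al) ->
  (be = 0 -> 0 <= al) -> gy * qx <= gx * qy.
Proof.
move=> gx0 gy0 H Hinf.
apply: (@binary_form_Slemma _ _ (gx + gy - be) _ _ (qx + qy - al)) => // t.
have [->|t1] := eqVneq t (-1).
  move=> h; have /Hinf : be = 0 by rewrite -h; ring.
  by congr (_ <= _); ring.
have t10 : 1 + t != 0 by rewrite addrC addr_eq0.
move=> h; have /H : (1 - t / (1 + t)) * gx + t / (1 + t) * gy
    - t / (1 + t) * (1 - t / (1 + t)) * be = 0.
  apply: (mulIf (expf_neq0 2 t10)); rewrite mul0r -h.
  by field.
have -> : (1 - t / (1 + t)) * qx + t / (1 + t) * qy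
    - t / (1 + t) * (1 - t / (1 + t)) * al
  = (qx + t * (qx + qy - al) + t ^+ 2 * qy) / (1 + t) ^+ 2 by field.
by rewrite pmulr_lge0// invr_gt0 lt_def expf_neq0// sqr_ge0.
Qed.

(** For [e <= 1] the perturbation is at most [e * (|p1| + |p2|)], which is below [e * c <= p0]; the
    [+ 1] in [c] keeps this strict. *)
Lemma quadratic_gt0_near0 (R : realFieldType) (p0 p1 p2 : R) : 0 < p0 ->
  exists2 d : R, 0 < d &
    forall e, 0 < e -> e <= d -> 0 < p0 + e * p1 + e ^+ 2 * p2.
Proof.
move=> p00; set c := `|p1| + `|p2| + 1.
have c0 : 0 < c by rewrite ltr_wpDl// addr_ge0.
exists (Num.min 1 (p0 / c)) => [|e e0]; first by rewrite lt_min ltr01 divr_gt0.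
rewrite le_min ler_pdivlMr// => /andP[e1 ec].
have : - (e * `|p1|) <= e * p1 by rewrite -mulrN ler_pM2l// lerNl -normrN ler_norm.
have : - (e * `|p2|) <= e ^+ 2 * p2.
  rewrite lerNl -mulrN; apply: (@le_trans _ _ (e ^+ 2 * `|p2|)).
    by rewrite ler_pM2l ?exprn_gt0// -normrN ler_norm.
  by rewrite ler_wpM2r// expr2 ler_piMl// ltW.
by rewrite /c in ec; lra.
Qed.

(** Substituting [s = 1 / e] and multiplying by [e ^+ 2] makes [p2] the constant term, whose sign
    prevails for small [e]. *)
Lemma quadratic_lead_ge0 (R : realFieldType) (p0 p1 p2 : R) :
  (forall s, 1 <= s -> 0 <= p0 + s * p1 + s ^+ 2 * p2) -> 0 <= p2.
Proof.
move=> H; rewrite leNgt; apply/negP => p20.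
have [|d d0 hd] := @quadratic_gt0_near0 _ (- p2) (- p1) (- p0); first lra.
set e := Num.min 1 d; have e0 : 0 < e by rewrite lt_min ltr01 d0.
have /hd : e <= d by rewrite ge_min lexx orbT.
move=> /(_ e0).
have : 1 <= e^-1 by rewrite invf_ge1// ge_min lexx.
move=> /H h.
have : 0 <= e ^+ 2 * (p0 + e^-1 * p1 + e^-1 ^+ 2 * p2) by rewrite mulr_ge0// sqr_ge0.
have -> : e ^+ 2 * (p0 + e^-1 * p1 + e^-1 ^+ 2 * p2) = p2 + e * p1 + e ^+ 2 * p0.
  by field; lra.
lra.
Qed.

(** * Quadratic functions on column vectors *)

Section Quadratic.
Variables (R : realType) (n : nat).
Implicit Types (u v w x y : 'cV[R]_n) (M : 'M[R]_n).

Lemma dotC u v : dot u v = dot v u.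
Proof. by apply: eq_bigr => i _; rewrite mulrC. Qed.

Lemma dotDr u v w : dot u (v + w) = dot u v + dot u w.
Proof. by rewrite -big_split; apply: eq_bigr => i _; rewrite mxE mulrDr. Qed.

Lemma dotZr u v (c : R) : dot u (c *: v) = c * dot u v.
Proof. by rewrite mulr_sumr; apply: eq_bigr => i _; rewrite mxE mulrCA. Qed.

Lemma dotDl u v w : dot (u + v) w = dot u w + dot v w.
Proof. by rewrite !(dotC _ w) dotDr. Qed.

Lemma dotZl u v (c : R) : dot (c *: u) v = c * dot u v.
Proof. by rewrite !(dotC _ v) dotZr. Qed.

Lemma dot0l u : dot 0 u = 0.
Proof. by rewrite -(scale0r 0) dotZl mul0r. Qed.

Lemma dotE u v : dot u v = (u^T *m v) 0 0.
Proof. by rewrite mxE; apply: eq_bigr => i _; rewrite mxE. Qed.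

Lemma dot_mulmxl M u v : dot (M *m u) v = dot u (M^T *m v).
Proof. by rewrite !dotE trmx_mul mulmxA. Qed.

Lemma quadfun_line M u (k : R) x v (s : R) :
  quadfun M u k (x + s *: v) = quadfun M u k x
    + s * (2^-1 * (dot (M *m x) v + dot (M *m v) x) + dot u v)
    + s ^+ 2 * (2^-1 * dot (M *m v) v).
Proof.
rewrite /quadfun mulmxDr -scalemxAr !(dotDl, dotDr, dotZl, dotZr).
ring.
Qed.

(** Brings the restriction to a line into the form required by [segment_Slemma]; the case [s = 1] of
    the expansion eliminates the linear coefficient. *)
Lemma quadfun_segment M u (k : R) x y (s : R) :
  quadfun M u k (x + s *: (y - x)) =
    (1 - s) * quadfun M u k x + s * quadfun M u k y
    - s * (1 - s) * (2^-1 * dot (M *m (y - x)) (y - x)).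
Proof.
have := quadfun_line M u k x (y - x) 1.
rewrite scale1r addrC subrK => ->.
by rewrite quadfun_line; ring.
Qed.

(** Polarization: if every vector is isotropic, symmetry makes the bilinear form vanish, and unit
    vectors read off the entries of [M]. *)
Lemma sym_form_neq0 M : M^T = M -> M <> 0 ->
  exists v, dot (M *m v) v != 0.
Proof.
move=> Msym M0; apply: contrapT => H; apply: M0.
have q0 v : dot (M *m v) v = 0.
  by apply: contrapT => /eqP h; apply: H; exists v.
have d0 u v : dot (M *m u) v = 0.
  have := q0 (u + v); rewrite mulmxDr !(dotDl, dotDr) !q0 add0r addr0.
  rewrite [dot (M *m v) u]dot_mulmxl Msym [dot v _]dotC => h; lra.
apply/matrixP => i j; rewrite mxE -(d0 (delta_mx j 0) (delta_mx i 0)).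
rewrite /dot (bigD1 i)//= big1 => [|l /negbTE li]; last first.
  by rewrite [delta_mx i 0 _ _]mxE li mulr0.
by rewrite -colE [delta_mx i 0 _ _]mxE !mxE !eqxx mulr1 addr0.
Qed.

End Quadratic.

(* Any multiplier [lambda] has to satisfy [- q x / g x <= lambda <= q y / - g y]
   for all [x], [y] with [g y < 0 < g x]; the cross inequality says that these
   bounds are compatible. *)
Lemma multiplier_of_cross (R : realType) (T : Type) (q g : T -> R) :
  (exists x, 0 < g x) -> (exists y, g y < 0) ->
  (forall x, g x = 0 -> 0 <= q x) ->
  (forall x y, 0 < g x -> g y < 0 -> g y * q x <= g x * q y) ->
  exists lambda : R, forall x, 0 <= q x + lambda * g x.
Proof.
move=> [x0 gx0] [y0 gy0] q0 cross.
pose L := [set - q x / g x | x in [set x | 0 < g x]].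
have Lub y : g y < 0 -> ubound L (q y / - g y).
  move=> gy _ [x /= gx <-]; rewrite ler_pdivrMr// mulrAC ler_pdivlMr ?oppr_gt0//.
  by rewrite mulrNN mulrC [leRHS]mulrC cross.
have Lsup : has_sup L.
  by split; [exists (- q x0 / g x0), x0|exists (q y0 / - g y0); exact: Lub].
exists (sup L) => x; have [gx|gx|gx] := ltgtP (g x) 0.
- have : sup L <= q x / - g x by apply: ge_sup => //; [case: Lsup|exact: Lub].
  rewrite ler_pdivlMr ?oppr_gt0//; lra.
- have : - q x / g x <= sup L by apply: ub_le_sup; [case: Lsup|exists x].
  by rewrite ler_pdivrMr//; lra.
- by rewrite gx mulr0 addr0 q0.
Qed.

(** Zeros of [g] on the line through [x] and [y] feed [segment_Slemma]. For [B = 0] every direction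
    is isotropic, hence the separate sign condition on [A]. *)
Lemma quadfun_cross (R : realType) (n : nat) (A B : 'M[R]_n) (a b : 'cV[R]_n)
    (k1 k2 : R) :
  let q := quadfun A a k1 in let g := quadfun B b k2 in
  B^T = B -> (forall x, g x = 0 -> 0 <= q x) ->
  (B = 0 -> forall x y, 0 < g x -> g y < 0 -> 0 <= dot (A *m (y - x)) (y - x)) ->
  forall x y, 0 < g x -> g y < 0 -> g y * q x <= g x * q y.
Proof.
move=> q g Bsym q0 HB0.
have generic x y : 0 < g x -> g y < 0 ->
    (dot (B *m (y - x)) (y - x) = 0 -> 0 <= dot (A *m (y - x)) (y - x)) ->
    g y * q x <= g x * q y.
  move=> gx gy H.
  apply: (@segment_Slemma _ _ _ (2^-1 * dot (B *m (y - x)) (y - x)) _ _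
    (2^-1 * dot (A *m (y - x)) (y - x))) => // [s|h].
  - by rewrite -!quadfun_segment; exact: q0.
  - by rewrite mulr_ge0//; apply: H; lra.
have [B0 x y gx gy|/eqP B0 x y gx gy] := eqVneq B 0.
  by apply: generic => // _; exact: HB0.
(* For [B <> 0], moving [y] along a direction [v] that is not isotropic for [B]
   makes [y - x] non-isotropic, and the inequality passes to the limit. *)
have [v v0] := sym_form_neq0 Bsym B0.
rewrite leNgt; apply/negP => bad.
set z := fun e => y + e *: v.
set c0 := dot (B *m (y - x)) (y - x).
set c1 := dot (B *m (y - x)) v + dot (B *m v) (y - x).
set c2 := dot (B *m v) v.
have zE e : dot (B *m (z e - x)) (z e - x) = c0 + e * c1 + e ^+ 2 * c2.
  rewrite /z addrAC /c0 /c1 /c2; move: (y - x) => w.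
  by rewrite mulmxDr -scalemxAr !(dotDl, dotDr, dotZl, dotZr); ring.
have [c00|c00] := eqVneq c0 0; last first.
  by move: bad; rewrite ltNge generic// => /eqP; rewrite (negbTE c00).
have gz e : g (z e) = g y
    + e * (2^-1 * (dot (B *m y) v + dot (B *m v) y) + dot b v)
    + e ^+ 2 * (2^-1 * dot (B *m v) v) by exact: quadfun_line.
have qz e : q (z e) = q y
    + e * (2^-1 * (dot (A *m y) v + dot (A *m v) y) + dot a v)
    + e ^+ 2 * (2^-1 * dot (A *m v) v) by exact: quadfun_line.
move: gz qz; set g1 := _ + dot b v; set g2 := 2^-1 * dot (B *m v) v.
set q1 := _ + dot a v; set q2 := 2^-1 * dot (A *m v) v => gz qz.
(* For small [e], [z e] keeps [g] negative, still violates the inequality, and makes [z e - x]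
   non-isotropic, contradicting [generic]. *)
have [d1 d10 h1] : exists2 d, 0 < d & forall e, 0 < e -> e <= d -> g (z e) < 0.
  have := @quadratic_gt0_near0 _ (- g y) (- g1) (- g2).
  rewrite oppr_gt0 => /(_ gy)[d d0 h]; exists d => // e e0 /h -/(_ e0).
  by rewrite gz; lra.
have [d2 d20 h2] : exists2 d, 0 < d &
    forall e, 0 < e -> e <= d -> g x * q (z e) < g (z e) * q x.
  have := @quadratic_gt0_near0 _ (g y * q x - g x * q y)
    (g1 * q x - g x * q1) (g2 * q x - g x * q2).
  rewrite subr_gt0 => /(_ bad)[d d0 h]; exists d => // e e0 /h -/(_ e0).
  by rewrite gz qz; lra.
have [d3 d30 h3] : exists2 d, 0 < d &
    forall e, 0 < e -> e <= d -> dot (B *m (z e - x)) (z e - x) != 0.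
  have [c10|c10] := eqVneq c1 0.
    exists 1 => // e e0 _; rewrite zE c00 c10 mulr0 !add0r mulf_neq0// expf_neq0//.
    by rewrite gt_eqF.
  (* These are the coefficients of [(c1 + e * c2) ^+ 2]: squaring turns nonvanishing into
     positivity. *)
  have := @quadratic_gt0_near0 _ (c1 ^+ 2) (2 * c1 * c2) (c2 ^+ 2).
  rewrite lt_def sqr_ge0 sqrf_eq0 c10 => /(_ isT)[d d0 h]; exists d => // e e0 ed.
  have {h} : 0 < (c1 + e * c2) ^+ 2 by move: (h e e0 ed); congr is_true; congr (0 < _); ring.
  rewrite lt_def sqrf_eq0 => /andP[h _].
  rewrite zE c00; have -> : 0 + e * c1 + e ^+ 2 * c2 = e * (c1 + e * c2) by ring.
  by rewrite mulf_neq0// gt_eqF.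
set e := Num.min d1 (Num.min d2 d3).
have e0 : 0 < e by rewrite !lt_min d10 d20.
have [ed1 ed2 ed3] : [/\ e <= d1, e <= d2 & e <= d3].
  by rewrite !ge_min !lexx !orbT.
have := h2 e e0 ed2; rewrite ltNge generic ?h1// => /eqP.
by rewrite (negbTE (h3 e e0 ed3)).
Qed.

(** The set contains 0 and [c], so its affine hull is the whole line, [z] being the combination of
    [c] and 0 with weights [z / c] and [1 - z / c]; relative neighbourhoods of 0 are then ordinary
    ones. *)
Lemma ri_two_sided (R : realType) (S : set R) (c : R) :
  c != 0 -> S c -> ri S 0 -> exists2 e : R, 0 < e & S e /\ S (- e).
Proof.
move=> c0 Sc [hull0 near0].
have S0 : S 0 by exact: (nbhs_singleton near0).
have hullT z : affine_hull S z.
  exists 2%N, (fun i : 'I_2 => if i == 0 then z / c else 1 - z / c),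
    (fun i : 'I_2 => if i == 0 then c else 0); split.
  - by rewrite !big_ord_recl big_ord0 /= addr0 addrC subrK.
  - by move=> i; case: ifP.
  - rewrite !big_ord_recl big_ord0 /= scaler0 !addr0.
    by rewrite /GRing.scale/= divfK.
move: near0 => /nbhs_ballP[e /= e0 he].
exists (e / 2); first by rewrite divr_gt0.
split; apply: he => //; rewrite /ball/= sub0r ?opprK ?normrN gtr0_norm; lra.
Qed.

Unset Implicit Arguments.
Set Strict Implicit.

Theorem theorem5p5 (R : realType) (n : nat) (A B : 'M[R]_n) (a b : 'cV[R]_n)
    (k1 k2 : R) (P : set R) :
  let f := quadfun A a k1 in
  let g := quadfun B b k2 in
  let feasible := [set x : 'cV[R]_n | set_opp P (g x)] in
  A^T = A ->
  B^T = B ->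
  (P = [set p : R | 0 <= p] \/ P = [set 0]) ->
  ri (set_add (range g) P) 0 ->
  infimum f feasible \is a fin_num ->
  (P = [set 0] ->
     (exists x, g x <> 0) /\
     [\/ B = 0 /\ (exists u : 'cV[R]_n,
                     A *m u = 0 /\ (dot a u, dot b u) <> (0, 0)),
         B <> 0
       | B = 0 /\ psd A]) ->
  exists2 lambda : R, polar_cone P lambda &
    infimum f feasible = infimum (fun x => f x + lambda * g x) setT.
Proof.
move=> f g feasible Asym Bsym HP ri0 finmu HC.
set mu := fine (infimum f feasible).
have muE : infimum f feasible = mu%:E by rewrite fineK.
have fmu x : feasible x -> 0 <= f x - mu.
  move=> Fx; rewrite subr_ge0 -lee_fin -muE; apply: ereal_inf_lbound.
  by exists x.
suff [lambda Plambda H] : exists2 lambda, polar_cone P lambda &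
    forall x, 0 <= f x - mu + lambda * g x.
  exists lambda => //; apply/eqP; rewrite eq_le; apply/andP; split.
    apply/ereal_infP => _ [x _ <-]; rewrite muE lee_fin.
    by have := H x; lra.
  apply/ereal_infP => _ [x Fx <-].
  apply: (@le_trans _ _ (f x + lambda * g x)%:E).
    by apply: ereal_inf_lbound; exists x.
  rewrite lee_fin gerDl; move: Fx => [p Pp <-].
  by rewrite mulrN oppr_le0; exact: Plambda.
have qE x : f x - mu = quadfun A a (k1 - mu) x by rewrite /f /quadfun addrA.
have q0 x : P 0 -> g x = 0 -> 0 <= quadfun A a (k1 - mu) x.
  by move=> P0 gx; rewrite -qE; apply: fmu; exists 0; rewrite ?oppr0 ?gx.
have S0 : set_add (range g) P 0 by case: ri0 => h0 /nbhs_singleton /(_ h0).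
case: HP => PE.
  have Fle x : g x <= 0 -> 0 <= quadfun A a (k1 - mu) x.
    move=> gx; rewrite -qE; apply: fmu; exists (- g x); rewrite ?opprK// PE /=.
    by rewrite oppr_ge0.
  have [y0 gy0] : exists y, g y < 0.
    (* A Slater point: [- e = g y + p] with [0 <= p] forces [g y < 0]. The nonzero element 1 comes
       from 0 by adding 1 to the summand in [P]. *)
    have [|e e0 [_ [_ [y _ <-] [p + ye]]]] := ri_two_sided (oner_neq0 R) _ ri0.
      case: S0 => s rs [p]; rewrite PE /= => p0 sp.
      by exists s => //; exists (p + 1);
        [rewrite /= addr_ge0|rewrite addrA sp add0r].
    by rewrite PE /= => p0; exists y; lra.
  have [gle|[x0 gx0]] : (forall x, g x <= 0) \/ exists x, 0 < g x.
    have [H|H] := pselect (exists x, 0 < g x); [by right|left => x].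
    by rewrite leNgt; apply/negP => gx; apply: H; exists x.
    exists 0 => [p _|x]; first by rewrite mul0r.
    by rewrite mul0r addr0 qE Fle.
  have [||||lambda H] := @multiplier_of_cross _ _ (quadfun A a (k1 - mu)) g.
  - by exists x0.
  - by exists y0.
  - by move=> x gx; apply: Fle; rewrite gx.
  - apply: quadfun_cross => // [x gx|B0 x y gx gy]; first by apply: Fle; rewrite /g gx.
    (* The ray from [x] through [y] is feasible beyond [y]. *)
    suff : 0 <= 2^-1 * dot (A *m (y - x)) (y - x) by lra.
    apply: (@quadratic_lead_ge0 _ (quadfun A a (k1 - mu) x)
      (quadfun A a (k1 - mu) y - quadfun A a (k1 - mu) x
        - 2^-1 * dot (A *m (y - x)) (y - x))) => s s1.
    have := Fle (x + s *: (y - x)); rewrite /g !quadfun_segment B0 mul0mx dot0l.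
    rewrite -B0 -/g => h.
    have /h : (1 - s) * g x + s * g y - s * (1 - s) * (2^-1 * 0) <= 0.
      have : 0 <= (s - 1) * g x by rewrite mulr_ge0 ?subr_ge0// ltW.
      have : s * g y <= 0 by rewrite pmulr_rle0 ?ltW//; lra.
      lra.
    by congr (_ <= _); ring.
  (* Truncation at 0 is harmless: where [g x > 0] a larger multiplier only helps, and where
     [g x <= 0] the point is feasible, so multiplier 0 works too. *)
  exists (Num.max lambda 0) => [p|x].
    by rewrite PE => p0; rewrite mulr_ge0// le_max lexx orbT.
  rewrite qE; have Hx := H x; have [gx|gx] := lerP (g x) 0.
    by case: (leP lambda 0) => // _; rewrite mul0r addr0 Fle.
  apply: le_trans Hx _; rewrite lerD2l ler_pM2r//.
  by rewrite le_max lexx.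
have P0 : P 0 by rewrite PE.
have [[x1 gx1] C] := HC PE.
have Srange s : set_add (range g) P s -> exists x, g x = s.
  by rewrite PE => -[_ [x _ <-] [_ -> <-]]; exists x; rewrite addr0.
(* Here the set is the range of [g], so a nonzero value of [g] yields values of both signs. *)
have [||e e0 [/Srange[xp gxp] /Srange[xm gxm]]] := @ri_two_sided _ _ (g x1) _ _ ri0.
- exact/eqP.
- by exists (g x1) => //; exists 0; rewrite ?addr0.
have polar0 l : polar_cone P l by move=> p; rewrite PE => ->; rewrite mulr0.
have conclude : (B = 0 -> forall x y, 0 < g x -> g y < 0 ->
      0 <= dot (A *m (y - x)) (y - x)) ->
    exists2 lambda, polar_cone P lambda & forall x, 0 <= f x - mu + lambda * g x.
  move=> HB.
  have [||||lambda H] := @multiplier_of_cross _ _ (quadfun A a (k1 - mu)) g.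
  - by exists xp; rewrite gxp.
  - by exists xm; rewrite gxm oppr_lt0.
  - by move=> x; exact: q0.
  - by apply: quadfun_cross => // x; exact: q0.
  by exists lambda => // x; rewrite qE.
case: C => [[B0 [u [Au abu]]]|B0|[B0 Apsd]]; last 2 first.
- by apply: conclude => /B0.
- by apply: conclude => _ x y _ _; exact: Apsd.
have fu x t : f (x + t *: u) = f x + t * dot a u.
  by rewrite /f quadfun_line dot_mulmxl Asym Au [dot x 0]dotC !dot0l; ring.
have gu x t : g (x + t *: u) = g x + t * dot b u.
  by rewrite /g quadfun_line B0 !mul0mx !dot0l; ring.
have fmu0 x : g x = 0 -> 0 <= f x - mu by move=> gx; rewrite qE q0.
have [bu|bu] := eqVneq (dot b u) 0.
  have au : dot a u != 0 by apply: contra_notN abu => /eqP ->; rewrite bu.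
  have [x0 gx0] := Srange 0 S0.
  (* Moving along [u] preserves [g] but changes [f]; this step length would bring [f] down to
     [mu - 1] at a feasible point. *)
  have /fmu0 : g (x0 + ((mu - f x0 - 1) / dot a u) *: u) = 0.
    by rewrite gu bu mulr0 addr0.
  by rewrite fu divfK//; lra.
exists (- (dot a u / dot b u)) => // x.
(* Sliding [x] along [u] to the zero set of [g] leaves [f + lambda g] unchanged, and there it equals
   [f]. *)
have /fmu0 : g (x + (- (g x / dot b u)) *: u) = 0.
  by rewrite gu mulNr divfK// subrr.
by rewrite fu; congr (_ <= _); ring.
Qed.
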